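(* A commutative van Rees loop has the weak inverse property; that is, if $Q$ is a commutative van Rees loop, then $x\cdot (yx)^2=y^2$ for all $x,y\in Q$.
   Context: A loop is a set with a binary operation whose left translations $y\mapsto xy$ and right translations $y\mapsto yx$ are all bijections and which has a two-sided neutral element $\varepsilon$. Loops $(Q,\cdot)$ and $(P,\circ)$ are isotopic if there are bijections $\alpha,\beta,\gamma:Q\to P$ with $\alpha(x)\circ\beta(y)=\gamma(x\cdot y)$ for all $x,y$. A loop has exponent $3$ if it satisfies $xx\cdot x=x\cdot xx=\varepsilon$ for all $x$. A van Rees loop is a loop $Q$ such that every loop isotopic to $Q$ has exponent $3$. Here $u^2=uu$. For loops of exponent $3$ (where $x^2$ is the inverse of $x$), the weak inverse property is the identity $x(yx)^2=y^2$. *)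

(* Defs.v *)
From HB Require Import structures.
From mathcomp Require Import all_boot.

Set Implicit Arguments.
Unset Strict Implicit.
Unset Printing Implicit Defensive.

Local Open Scope group_scope.

HB.mixin Record BaseUMagma_isLoop Q of BaseUMagma Q := {
  loop1x : forall x : Q, 1 * x = x;
  loopx1 : forall x : Q, x * 1 = x;
  loop_ltrans_bij : forall x : Q, bijective (fun y : Q => x * y);
  loop_rtrans_bij : forall x : Q, bijective (fun y : Q => y * x)
}.

(* The library's unitary magmas carry a choice structure; loops here are built
   on base unitary magmas instead, so that the carrier is an arbitrary type. *)
#[short(type="loopType")]
HB.structure Definition Loop := {Q of BaseUMagma_isLoop Q & BaseUMagma Q}.

Bind Scope group_scope with Loop.sort.

Definition isotopic (Q P : loopType) : Prop :=
  exists alpha beta gamma : Q -> P,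
    [/\ bijective alpha, bijective beta, bijective gamma
      & forall x y : Q, alpha x * beta y = gamma (x * y)].

Definition exponent3 (Q : loopType) : Prop :=
  forall x : Q, (x * x) * x = 1 /\ x * (x * x) = 1.

Definition van_Rees (Q : loopType) : Prop :=
  forall P : loopType, isotopic Q P -> exponent3 P.

(* With [x ^+ 2] the inverse of x, this is the weak inverse property
   x * (y * x)^-1 = y^-1, so it is meant for loops of exponent 3 only. *)
Definition weak_inverse3 (Q : loopType) : Prop :=
  forall x y : Q, x * (y * x) ^+ 2 = y ^+ 2.

(* Main.v *)
Require Import Defs.
From HB Require Import structures.
From mathcomp Require Import all_boot.

(** Fix [a] and [b]. As [Q] is commutative, the product
    [u o v = (a \ u) (a \ v)] is a loop isotopic to [Q], with neutral element
    [aa]. Put [u = ab] and let [ae = bb]: then [u o u = bb], so exponent 3 of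
    this isotope gives [be = u o (u o u) = aa] and
    [ee = (u o u) o (u o u) = u = ab]. By exponent 3 in [Q], [ee = ab] gives
    [e = (ab)^2], and [be = aa] becomes the weak inverse property. *)

Local Open Scope group_scope.

(* The carrier is [Q] itself; the other parameters only select the loop
   structure with product [(x / b) (a \ y)] put on it below. *)
Definition principal_isotope (Q : loopType) (a b : Q) (f g : Q -> Q)
    (fK : cancel f ( *%g^~ b)) (Kf : cancel ( *%g^~ b) f)
    (gK : cancel g ( *%g a)) (Kg : cancel ( *%g a) g) : Type :=
  Q.

Section PrincipalIsotope.

Variables (Q : loopType) (a b : Q) (f g : Q -> Q).
Hypotheses (fK : cancel f ( *%g^~ b)) (Kf : cancel ( *%g^~ b) f).
Hypotheses (gK : cancel g ( *%g a)) (Kg : cancel ( *%g a) g).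

Local Notation P := (principal_isotope Q a b f g fK Kf gK Kg).

HB.instance Definition _ := hasMul.Build P (fun x y : Q => f x * g y).
HB.instance Definition _ := hasOne.Build P (a * b : Q).

Lemma principal_isotope_mul1x (x : P) : 1 * x = x.
Proof. by rewrite [LHS](_ : _ = f (a * b) * g x) // Kf gK. Qed.

Lemma principal_isotope_mulx1 (x : P) : x * 1 = x.
Proof. by rewrite [LHS](_ : _ = f x * g (a * b)) // Kg fK. Qed.

Lemma principal_isotope_ltrans_bij (x : P) : bijective (fun y : P => x * y).
Proof. exact: (bij_comp (loop_ltrans_bij (f x)) (Bijective gK Kg)). Qed.

Lemma principal_isotope_rtrans_bij (x : P) : bijective (fun y : P => y * x).
Proof. exact: (bij_comp (loop_rtrans_bij (g x)) (Bijective fK Kf)). Qed.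

HB.instance Definition _ := BaseUMagma_isLoop.Build P
  principal_isotope_mul1x principal_isotope_mulx1
  principal_isotope_ltrans_bij principal_isotope_rtrans_bij.

(** [f] and [g] undo the translations by [b] and [a], so the third map can be the identity. *)
Lemma isotopic_principal_isotope : isotopic Q P.
Proof.
exists (fun x => x * b), (fun y => a * y), id.
split; [exact: (loop_rtrans_bij b) | exact: (loop_ltrans_bij a) | by exists id |].
by move=> x y; rewrite [LHS](_ : _ = f (x * b) * g (a * y)) // Kf Kg.
Qed.

End PrincipalIsotope.

(** Both sides are right inverses of [x * x], by exponent 3 at [x * x] and at [x]; cancel on the
    left. *)
Lemma exponent3_sqrK (Q : loopType) (x : Q) :
  exponent3 Q -> (x * x) * (x * x) = x.
Proof.
move=> Q3; apply: (bij_inj (loop_ltrans_bij (x * x))).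
by rewrite (Q3 _).2 (Q3 x).1.
Qed.

Theorem theorem10 (Q : loopType) (Qcomm : commutative (@mul Q))
  (QvanRees : van_Rees Q) : weak_inverse3 Q.
Proof.
have Q3 : exponent3 Q.
  by apply: QvanRees; exists id, id, id; split=> //; exists id.
move=> b a; rewrite !expg2.
have [g Kg gK] := loop_ltrans_bij a.
(* By commutativity, left division by [a] is also right division, so [g] serves both factors. *)
have fK : cancel g ( *%g^~ a) by move=> x; rewrite Qcomm gK.
have Kf : cancel ( *%g^~ a) g by move=> x; rewrite Qcomm Kg.
pose P : loopType := principal_isotope Q a a g g fK Kf gK Kg.
have P3 : exponent3 P by exact/QvanRees/isotopic_principal_isotope.
have be : b * g (b * b) = a * a.
  by have := (P3 (a * b)).2; rewrite /mul /= !Kg.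
have ee : g (b * b) * g (b * b) = a * b.
  by have := exponent3_sqrK P (a * b) P3; rewrite /mul /= !Kg.
(* With [e = g (b * b)], the square of [a * b = e * e] is [e], which leaves [be]. *)
by rewrite -ee exponent3_sqrK.
Qed.
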